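(* Let $(W,S)$ be a Coxeter system, $R$ a fusion ring with basis $\mathfrak B$, and $R\Lambda_S$ a geometric $R$-realisation of $(W,S)$ with unfolded Coxeter system $(\check W,\check S)$. Then the unfolding homomorphism $\varphi:W\to\check W$, $s\mapsto\prod_{b\in\mathfrak B}(b,s)$, is injective.
   Context: Coxeter systems: $S$ is a finite set, $(m_{s,t})_{s,t\in S}$ is a symmetric matrix with $m_{s,s}=1$ and $m_{s,t}\in\{2,3,\dots,\infty\}$ for $s\ne t$, and $W=\langle S\mid (st)^{m_{s,t}}=1 \text{ whenever } m_{s,t}<\infty\rangle$. Rings are unital and associative, not necessarily commutative. Fusion ring: a ring $R$, free as a $\mathbb Z$-module on a finite basis $\mathfrak B=\{b_1,\dots,b_n\}$ with $b_1=1$, such that every product $b_jb_k=\sum_i {}_jc_{k,i}b_i$ is non-zero with all ${}_jc_{k,i}\in\mathbb Z_{\ge0}$, together with an involution $b_j\mapsto b_j^*=b_{j^*}$ of $\mathfrak B$ whose $\mathbb Z$-linear extension $*:R\to R$ satisfies $(rs)^*=s^*r^*$, and such that the coefficient of $1$ in $b_jb_k$ is $1$ if $k=j^*$ and $0$ otherwise. $R_{\ge0}$ is the set of non-negative integral combinations of $\mathfrak B$. $\mathrm{FPdim}(b_j)$ is the largest non-negative real (Frobenius–Perron) eigenvalue of the matrix $({}_jc_{k,\ell})_{k,\ell}$; extended $\mathbb Z$-linearly, $\mathrm{FPdim}:R\to\mathbb R$ is a ring homomorphism. Geometric $R$-realisation: $R\Lambda_S=\bigoplus_{s\in S}R\alpha_s$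 is the free left $R$-module, with a $\mathbb Z$-bilinear form $B_R:R\Lambda_S\times R\Lambda_S\to R$ such that $B_R(x\alpha_s,y\alpha_t)=y\,r_{s,t}\,x^*$ where $r_{s,t}=B_R(\alpha_s,\alpha_t)$ and $r_{s,s}=2$, such that $s(v)=v-B_R(\alpha_s,v)\alpha_s$ ($s\in S$) induces a well-defined left $R$-linear action of $W$ on $R\Lambda_S$; and, for $s\ne t$: $-r_{s,t}\in R_{\ge0}$, $r_{t,s}=r_{s,t}^*$, $\mathrm{FPdim}(r_{s,t})=-2\cos(\pi/m_{s,t})$ if $m_{s,t}<\infty$, and $\mathrm{FPdim}(r_{s,t})\le-2$ if $m_{s,t}=\infty$. Unfolded Coxeter system $(\check W,\check S)$: $\check S=\mathfrak B\times S$. For $(b_i,s),(b_j,t)\in\check S$ define integers $\check r_{(b_i,s),(b_j,t)}$ by: $2$ if $(b_i,s)=(b_j,t)$, $0$ if $s=t$ and $i\ne j$, and for $s\neq t$ by $b_j r_{s,t}=\sum_i \check r_{(b_i,s),(b_j,t)}b_i$. Distinct vertices are joined by an edge of the Coxeter graph iff $\check r\ne0$; the label is $3$ if $\check r=-1$ and $\infty$ if $\check r\le-2$ (no edge means $m=2$). The map $\varphi$ on generators extends to a well-defined group homomorphism (for fixed $s$ the factors $(b,s)$ commute). *)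

(* Defs.v *)
From HB Require Import structures.
From mathcomp Require Import all_boot all_order all_algebra.
From mathcomp Require Import boolp classical_sets reals topology normedtype.
From mathcomp Require Import sequences derive realfun exp trigo.
Set Implicit Arguments.
Unset Strict Implicit.
Unset Printing Implicit Defensive.
Import Order.TTheory GRing.Theory Num.Theory.

Section Presentation.
Local Open Scope group_scope.
Local Open Scope quotient_scope.
Variables (X : choiceType) (rel : seq (X * bool) -> Prop).

(* The letter [(x, true)] stands for x and [(x, false)] for x^-1. *)
Inductive pres_eq : seq (X * bool) -> seq (X * bool) -> Prop :=
| pres_refl u : pres_eq u u
| pres_sym u v : pres_eq u v -> pres_eq v u
| pres_trans u v w : pres_eq u v -> pres_eq v w -> pres_eq u w
| pres_cat u u' v v' : pres_eq u u' -> pres_eq v v' -> pres_eq (u ++ v) (u' ++ v')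
| pres_cancel x b : pres_eq [:: (x, b); (x, ~~ b)] [::]
| pres_rel u : rel u -> pres_eq u [::].

Definition pres_eqb (u v : seq (X * bool)) : bool := `[< pres_eq u v >].

Lemma pres_eqb_refl : reflexive pres_eqb.
Proof. by move=> u; apply/asboolP; apply: pres_refl. Qed.

Lemma pres_eqb_sym : symmetric pres_eqb.
Proof. by move=> u v; apply: asbool_equiv_eq; split=> /pres_sym. Qed.

Lemma pres_eqb_trans : transitive pres_eqb.
Proof.
move=> v u w /asboolP uv /asboolP vw; apply/asboolP; exact: pres_trans uv vw.
Qed.

Definition pres_equiv : equiv_rel (seq (X * bool)) :=
  EquivRel pres_eqb pres_eqb_refl pres_eqb_sym pres_eqb_trans.

Definition presented_group := {eq_quot pres_equiv}.
HB.instance Definition _ := Choice.copy presented_group {eq_quot pres_equiv}.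

Definition pres_class (u : seq (X * bool)) : presented_group :=
  \pi_{eq_quot pres_equiv} u.

Lemma pres_classP u v : pres_class u = pres_class v <-> pres_eq u v.
Proof. by split=> [/eqmodP /asboolP|uv]; last by apply/eqmodP/asboolP. Qed.

Definition inv_word (u : seq (X * bool)) : seq (X * bool) :=
  rev [seq (xb.1, ~~ xb.2) | xb <- u].

Definition pres_mul (g h : presented_group) : presented_group :=
  pres_class (repr (g : {eq_quot pres_equiv}) ++ repr (h : {eq_quot pres_equiv})).
Definition pres_inv (g : presented_group) : presented_group :=
  pres_class (inv_word (repr (g : {eq_quot pres_equiv}))).

Lemma pres_repr u : pres_eq (repr (pres_class u : {eq_quot pres_equiv})) u.
Proof. by apply/pres_classP; rewrite /pres_class reprK. Qed.

Lemma pres_classK (g : presented_group) :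
  exists u, g = pres_class u.
Proof. by exists (repr (g : {eq_quot pres_equiv})); rewrite /pres_class reprK. Qed.

Lemma inv_wordK u : inv_word (inv_word u) = u.
Proof.
rewrite /inv_word map_rev revK -map_comp (eq_map (g := id)) ?map_id //.
by case=> x b /=; rewrite negbK.
Qed.

Lemma inv_word_l w : pres_eq (inv_word w ++ w) [::].
Proof.
elim: w => [|[x b] w IH]; first exact: pres_refl.
rewrite /inv_word /= rev_cons -cats1 -catA /=.
apply: pres_trans IH; apply: pres_cat (pres_refl _) _.
rewrite -[X in pres_eq _ X]cat0s -[_ :: _]/([:: (x, ~~ b); (x, b)] ++ w).
apply: pres_cat (pres_refl _).
by have := pres_cancel x (~~ b); rewrite negbK.
Qed.

Lemma inv_word_r w : pres_eq (w ++ inv_word w) [::].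
Proof. by have := inv_word_l (inv_word w); rewrite inv_wordK. Qed.

Lemma inv_word_eq u v : pres_eq u v -> pres_eq (inv_word u) (inv_word v).
Proof.
move=> uv; apply: (pres_trans (v := inv_word u ++ (v ++ inv_word v))).
  rewrite -[X in pres_eq X _]cats0; apply: pres_cat (pres_refl _) _.
  exact/pres_sym/inv_word_r.
rewrite catA -[X in pres_eq _ X]cat0s; apply: pres_cat (pres_refl _).
apply: pres_trans (inv_word_l u); apply: pres_cat (pres_refl _) _.
exact: pres_sym uv.
Qed.

Lemma pres_mulE u v : pres_mul (pres_class u) (pres_class v) = pres_class (u ++ v).
Proof. by apply/pres_classP/pres_cat; apply: pres_repr. Qed.

Lemma pres_invE u : pres_inv (pres_class u) = pres_class (inv_word u).
Proof. by apply/pres_classP/inv_word_eq/pres_repr. Qed.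

Lemma pres_mulA : associative pres_mul.
Proof.
move=> g h k; have [u ->] := pres_classK g; have [v ->] := pres_classK h.
by have [w ->] := pres_classK k; rewrite !pres_mulE catA.
Qed.

Lemma pres_mul1g : left_id (pres_class [::]) pres_mul.
Proof. by move=> g; have [u ->] := pres_classK g; rewrite pres_mulE. Qed.

Lemma pres_mulg1 : right_id (pres_class [::]) pres_mul.
Proof. by move=> g; have [u ->] := pres_classK g; rewrite pres_mulE cats0. Qed.

Lemma pres_mulVg : left_inverse (pres_class [::]) pres_inv pres_mul.
Proof.
move=> g; have [u ->] := pres_classK g; rewrite pres_invE pres_mulE.
exact/pres_classP/inv_word_l.
Qed.

Lemma pres_mulgV : right_inverse (pres_class [::]) pres_inv pres_mul.
Proof.
move=> g; have [u ->] := pres_classK g; rewrite pres_invE pres_mulE.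
exact/pres_classP/inv_word_r.
Qed.

HB.instance Definition _ := isGroup.Build presented_group
  pres_mulA pres_mul1g pres_mulg1 pres_mulVg pres_mulgV.

Definition pres_gen (x : X) : presented_group := pres_class [:: (x, true)].

Section UniversalProperty.
Variables (G : groupType) (f : X -> G).

Definition eval_word (u : seq (X * bool)) : G :=
  \big[*%g/1]_(xb <- u) (if xb.2 then f xb.1 else (f xb.1)^-1).

Hypothesis f_rel : forall u, rel u -> eval_word u = 1.

Lemma eval_pres_eq u v : pres_eq u v -> eval_word u = eval_word v.
Proof.
move=> e; elim: {u v} e => [u|u v _ ->|u v w _ -> _ ->|u u' v v' _ + _|x b|w /f_rel ->] //.
- by rewrite /eval_word !big_cat /= => -> ->.
- rewrite /eval_word !big_cons !big_nil mulg1.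
  by case: b; rewrite /= ?mulgV ?mulVg.
- by rewrite /eval_word big_nil.
Qed.

Definition pres_lift (g : presented_group) : G :=
  eval_word (repr (g : {eq_quot pres_equiv})).

Lemma pres_lift_class u : pres_lift (pres_class u) = eval_word u.
Proof. exact/eval_pres_eq/pres_repr. Qed.

Lemma pres_lift_gen x : pres_lift (pres_gen x) = f x.
Proof. by rewrite pres_lift_class /eval_word big_cons big_nil mulg1. Qed.

Lemma pres_liftM : {morph pres_lift : g h / g * h}.
Proof.
move=> g h; have [u ->] := pres_classK g; have [v ->] := pres_classK h.
by rewrite [_ * _]pres_mulE !pres_lift_class /eval_word big_cat.
Qed.

End UniversalProperty.

Lemma pres_gen_rel u : rel u -> eval_word pres_gen u = 1.
Proof.
move=> ru; suff -> : eval_word pres_gen u = pres_class u.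
  exact/pres_classP/pres_rel.
elim: u {ru} => [|[x b] u IH]; rewrite /eval_word ?big_nil // big_cons -/(eval_word _ _) IH.
by case: b; rewrite /= ?[_^-1]pres_invE [LHS]pres_mulE.
Qed.

Lemma pres_hom_ext (G : groupType) (phi psi : {multiplicative presented_group -> G}) :
  (forall x, phi (pres_gen x) = psi (pres_gen x)) -> phi =1 psi.
Proof.
have hom1 (chi : {multiplicative presented_group -> G}) : chi 1 = 1.
  by apply: (mulgI (chi 1)); rewrite -gmulfM !mulg1.
have homV (chi : {multiplicative presented_group -> G}) g : chi g^-1 = (chi g)^-1.
  by apply: (mulgI (chi g)); rewrite -gmulfM !mulgV hom1.
move=> eq_gen g; have [u ->] := pres_classK g.
elim: u => [|[x b] u IH]; first by rewrite [pres_class _]/(1 : presented_group) !hom1.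
have -> : pres_class ((x, b) :: u) =
    (if b then pres_gen x else (pres_gen x)^-1) * pres_class u.
  by case: b; rewrite /= ?[_^-1]pres_invE [RHS]pres_mulE.
by rewrite !gmulfM IH; case: b; rewrite ?homV eq_gen.
Qed.

End Presentation.

Section Coxeter.

(* [None] encodes the label infinity. *)
Record coxeterMatrix (S : finType) := CoxeterMatrix {
  cox_m :> S -> S -> option nat;
  cox_sym : forall s t, cox_m s t = cox_m t s;
  cox_diag : forall s, cox_m s s = Some 1%N;
  cox_offdiag : forall s t k, s != t -> cox_m s t = Some k -> (2 <= k)%N
}.

Variables (S : finType) (m : coxeterMatrix S).

Definition coxeter_relator (u : seq (S * bool)) : Prop :=
  exists s t k, m s t = Some k /\ u = flatten (nseq k [:: (s, true); (t, true)]).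

Definition coxeter_group : groupType := presented_group coxeter_relator.

Definition cox_gen (s : S) : coxeter_group := pres_gen coxeter_relator s.

End Coxeter.

Local Open Scope ring_scope.

Record fusionRing := FusionRing {
  fr_ring :> nzRingType;
  fr_rank : nat;
  (* b_1, .., b_n are indexed by 'I_n with n = fr_rank + 1 and b_1 = fr_basis ord0 *)
  fr_basis : 'I_fr_rank.+1 -> fr_ring;
  fr_coord : fr_ring -> 'I_fr_rank.+1 -> int;
  fr_dual : 'I_fr_rank.+1 -> 'I_fr_rank.+1;
  fr_star : {additive fr_ring -> fr_ring};
  fr_coordK : forall x, \sum_i fr_basis i *~ fr_coord x i = x;
  fr_coord_sum : forall (c : 'I_fr_rank.+1 -> int) i,
    fr_coord (\sum_j fr_basis j *~ c j) i = c i;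
  fr_basis1 : fr_basis ord0 = 1;
  fr_mul_neq0 : forall j k, fr_basis j * fr_basis k != 0;
  fr_mul_ge0 : forall j k i, 0 <= fr_coord (fr_basis j * fr_basis k) i;
  fr_dualK : involutive fr_dual;
  fr_star_basis : forall j, fr_star (fr_basis j) = fr_basis (fr_dual j);
  fr_starM : forall x y, fr_star (x * y) = fr_star y * fr_star x;
  fr_coef1 : forall j k,
    fr_coord (fr_basis j * fr_basis k) ord0 = (k == fr_dual j)%:R
}.

Section FusionRing.
Variable R : fusionRing.
Notation b := (@fr_basis R).
Notation coord := (@fr_coord R).
Notation dual := (@fr_dual R).
Notation star := (@fr_star R).

Definition fr_nonneg (x : R) : Prop := forall i, 0 <= coord x i.

Section FPdim.
Variable K : realType.

Definition fr_mx (j : 'I_(fr_rank R).+1) : 'M[K]_((fr_rank R).+1) :=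
  \matrix_(k, l) (coord (b j * b k) l)%:~R.

(* The set is finite, and non-empty by Perron-Frobenius, so that sup is max. *)
Definition FPdim_basis (j : 'I_(fr_rank R).+1) : K :=
  sup [set a : K | 0 <= a /\ eigenvalue (fr_mx j) a]%classic.

Definition FPdim (x : R) : K := \sum_i (coord x i)%:~R * FPdim_basis i.

End FPdim.

Lemma fr_coordD x y i : coord (x + y) i = coord x i + coord y i.
Proof.
rewrite -{1}(fr_coordK x) -{1}(fr_coordK y) -big_split /=.
under eq_bigr do rewrite -mulrzDr.
exact: fr_coord_sum (fun i => coord x i + coord y i) i.
Qed.

Lemma fr_coord0 i : coord 0 i = 0.
Proof. by apply: (addrI (coord 0 i)); rewrite -fr_coordD !addr0. Qed.

Lemma fr_coordN x i : coord (- x) i = - coord x i.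
Proof. by apply: (addrI (coord x i)); rewrite -fr_coordD !subrr fr_coord0. Qed.

Lemma fr_coord_mulz x n i : coord (x *~ n) i = coord x i * n.
Proof.
rewrite -{1}(fr_coordK x) mulrz_suml.
under eq_bigr do rewrite -mulrzA.
exact: fr_coord_sum (fun i => coord x i * n) i.
Qed.

Lemma fr_coord_big (I : Type) (s : seq I) (F : I -> R) i :
  coord (\sum_(j <- s) F j) i = \sum_(j <- s) coord (F j) i.
Proof.
by elim/big_rec2: _ => [|j y x _ <-]; rewrite ?fr_coord0 ?fr_coordD.
Qed.

Lemma fr_coord_basis j i : coord (b j) i = (i == j)%:R.
Proof.
rewrite -[b j](_ : \sum_k b k *~ (k == j)%:R = _).
  exact: fr_coord_sum (fun k => (k == j)%:R) i.
by rewrite (bigD1 j) //= eqxx big1 ?addr0 ?mulr1z // => k /negPf ->; rewrite mulr0z.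
Qed.

Lemma fr_dual0 : dual ord0 = ord0.
Proof.
have := fr_coef1 ord0 (dual ord0); rewrite fr_basis1 mul1r fr_coord_basis eqxx.
by case: eqP => [<-|].
Qed.

Lemma fr_coord_tau x i : coord x i = coord (x * b (dual i)) ord0.
Proof.
rewrite -{2}(fr_coordK x) mulr_suml fr_coord_big (bigD1 i) //= big1 => [|j ji].
  by rewrite mulrzAl fr_coord_mulz fr_coef1 eqxx mul1r addr0.
rewrite mulrzAl fr_coord_mulz fr_coef1 (inj_eq (can_inj (@fr_dualK R))).
by rewrite eq_sym (negPf ji) mul0r.
Qed.

Lemma fr_tau_star x : coord (star x) ord0 = coord x ord0.
Proof.
rewrite -{1}(fr_coordK x) raddf_sum fr_coord_big (bigD1 ord0) //= big1 => [|j j0].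
  by rewrite raddfMz fr_coord_mulz fr_star_basis fr_dual0 fr_coord_basis eqxx mul1r addr0.
rewrite raddfMz fr_coord_mulz fr_star_basis fr_coord_basis -[ord0]fr_dual0.
by rewrite (inj_eq (can_inj (@fr_dualK R))) eq_sym (negPf j0) mul0r.
Qed.

Lemma fr_coord_mul_star r i j : coord (b i * star r) j = coord (b j * r) i.
Proof.
rewrite [RHS]fr_coord_tau -fr_tau_star !fr_starM !fr_star_basis fr_dualK.
by rewrite [LHS]fr_coord_tau mulrA.
Qed.

End FusionRing.

(* R^o turns left multiplication into the scalar action, so that this is the
   free left R-module on S. *)
Definition free_module (R : fusionRing) (S : finType) : lmodType R :=
  {ffun S -> R^o}.

Definition simple_root (R : fusionRing) (S : finType) (s : S) : free_module R S :=
  [ffun t => (t == s)%:R].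

Record geomRealisation (K : realType) (S : finType) (m : coxeterMatrix S)
    (R : fusionRing) := GeomRealisation {
  gr_form : free_module R S -> free_module R S -> R;
  gr_formDl : forall u v w, gr_form (u + v) w = gr_form u w + gr_form v w;
  gr_formDr : forall u v w, gr_form u (v + w) = gr_form u v + gr_form u w;
  gr_formE : forall (x y : R) s t,
    gr_form (x *: simple_root R s) (y *: simple_root R t) =
    y * gr_form (simple_root R s) (simple_root R t) * fr_star R x;
  gr_diag : forall s, gr_form (simple_root R s) (simple_root R s) = 2%:R;
  gr_action : exists rho : coxeter_group m ->
      {linear free_module R S -> free_module R S},
    [/\ forall v, rho 1%g v = v,
        forall g h v, rho (g * h)%g v = rho g (rho h v) &
        forall s v, rho (cox_gen m s) v =
          v - gr_form (simple_root R s) v *: simple_root R s];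
  gr_nonpos : forall s t, s != t ->
    fr_nonneg (- gr_form (simple_root R s) (simple_root R t));
  gr_star : forall s t, s != t ->
    gr_form (simple_root R t) (simple_root R s) =
    fr_star R (gr_form (simple_root R s) (simple_root R t));
  gr_FPdim_fin : forall s t k, s != t -> m s t = Some k ->
    FPdim K (gr_form (simple_root R s) (simple_root R t)) = - 2%:R * cos (pi / k%:R);
  gr_FPdim_inf : forall s t, s != t -> m s t = None ->
    FPdim K (gr_form (simple_root R s) (simple_root R t)) <= - 2%:R
}.

Section Unfolding.
Variables (K : realType) (S : finType) (m : coxeterMatrix S) (R : fusionRing).
Variable L : geomRealisation K m R.

Definition unfolded_index : finType := ('I_(fr_rank R).+1 * S)%type.

Definition unfolded_r (p q : unfolded_index) : int :=
  if p == q then 2 else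
  if p.2 == q.2 then 0 else
  fr_coord (fr_basis q.1 *
    gr_form L (simple_root R p.2) (simple_root R q.2)) p.1.

Lemma unfolded_r_sym p q : unfolded_r p q = unfolded_r q p.
Proof.
rewrite /unfolded_r eq_sym; case: eqP => // _; rewrite eq_sym.
case: eqVneq => // st; by rewrite (gr_star L st) fr_coord_mul_star.
Qed.

(* Off the diagonal unfolded_r is non-positive, so that the last case is
   unfolded_r p q <= -2. *)
Definition unfolded_m (p q : unfolded_index) : option nat :=
  if p == q then Some 1%N else
  if unfolded_r p q == 0 then Some 2%N else
  if unfolded_r p q == -1 then Some 3%N else None.

Lemma unfolded_m_sym p q : unfolded_m p q = unfolded_m q p.
Proof. by rewrite /unfolded_m unfolded_r_sym eq_sym. Qed.

Lemma unfolded_m_diag p : unfolded_m p p = Some 1%N.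
Proof. by rewrite /unfolded_m eqxx. Qed.

Lemma unfolded_m_offdiag p q k : p != q -> unfolded_m p q = Some k -> (2 <= k)%N.
Proof.
by rewrite /unfolded_m => /negPf ->; case: ifP => [_ [<-]|_] //; case: ifP => [_ [<-]|].
Qed.

Definition unfolded : coxeterMatrix unfolded_index :=
  CoxeterMatrix unfolded_m_sym unfolded_m_diag unfolded_m_offdiag.

Definition unfolded_gens (s : S) : coxeter_group unfolded :=
  (\big[*%g/1]_(i < (fr_rank R).+1) cox_gen unfolded (i, s))%g.

End Unfolding.

(* Main.v *)
From HB Require Import structures.
Require Import Defs.
From mathcomp Require Import all_boot all_order all_algebra reals.
From mathcomp Require Import ring lra zify.
From mathcomp Require Import boolp classical_sets topology function_spaces.
From mathcomp Require Import normedtype derive trigo.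

(** Tits' argument shows that a Coxeter group acts faithfully through any
    geometric representation whose Cartan entries are [-2 cos (pi / m)] for finite
    [m] and at most [-2] for infinite [m].  The unfolded group has such a
    representation with the integral entries [unfolded_r], and on the free
    Z-module spanned by the roots [b alpha_s] the generator [s] of [W] acts as the
    product of the reflections in [(b, s)].  Faithfulness for the unfolded group
    therefore turns the relations of [W] into relations between these products,
    so that the unfolding is well defined.  An element of its kernel acts
    trivially on [R Lambda_S], hence, applying [FPdim] to the coordinates, on a
    real geometric representation of [W], and is trivial by faithfulness for [W].
    That [FPdim] is multiplicative comes from an eigenvector common to all left
    multiplications, namely the Perron-Frobenius eigenvector of the right
    multiplication by the sum of the basis. *)

Set Implicit Arguments.
Unset Strict Implicit.
Unset Printing Implicit Defensive.
Import Order.TTheory GRing.Theory Num.Theory.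

(** * Faithfulness of geometric representations *)

Section ChebyshevU.
Local Open Scope ring_scope.

(** In the usual notation this is U_{n-1}(a/2), the quantum integer [n]. *)
Fixpoint cheb (R : pzRingType) (a : R) (n : nat) : R :=
  if n is n1.+1 then (if n1 is n2.+1 then a * cheb a n1 - cheb a n2 else 1)
  else 0.

Lemma chebSS (R : pzRingType) (a : R) n :
  cheb a n.+2 = a * cheb a n.+1 - cheb a n.
Proof. by []. Qed.

Lemma cheb_ge0 (R : realDomainType) (a : R) n : 2 <= a -> 0 <= cheb a n.
Proof.
(* The recurrence subtracts, so monotonicity in [n] is carried through the induction. *)
move=> a2; suff /andP[] : 0 <= cheb a n <= cheb a n.+1 by [].
elim: n => [|n /andP[IH0 IH1]]; first by rewrite /= lexx ler01.
rewrite chebSS (le_trans IH0 IH1) lerBrDr andTb.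
apply: le_trans (ler_wpM2r (le_trans IH0 IH1) a2).
by rewrite mulr_natl mulr2n lerD2l.
Qed.

Lemma cheb_sin (K : realType) (x : K) n :
  cheb (2 * cos x) n * sin x = sin (n%:R * x).
Proof.
suff : cheb (2 * cos x) n * sin x = sin (n%:R * x) /\
    cheb (2 * cos x) n.+1 * sin x = sin (n.+1%:R * x) by case.
elim: n => [|n [IH0 IH1]]; first by rewrite /= !mul0r sin0 !mul1r.
split=> //; rewrite chebSS mulrBl -mulrA IH1 IH0.
have -> : n%:R * x = n.+1%:R * x - x by rewrite -[n.+1]addn1 natrD; ring.
have -> : n.+2%:R * x = n.+1%:R * x + x by rewrite -[n.+2]addn1 natrD; ring.
rewrite sinB sinD; ring.
Qed.

(** Multiplied by sin(pi/k) > 0, the value becomes sin(n pi/k), and n pi/k lies in [0, pi]. *)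
Lemma cheb_cos_ge0 (K : realType) k n :
  (2 <= k)%N -> (n <= k)%N -> 0 <= cheb (2 * cos (pi / k%:R : K)) n.
Proof.
move=> k2 nk; have k0 : 0 < k%:R :> K by rewrite ltr0n; lia.
have pi0 := pi_gt0 K.
have s0 : 0 < sin (pi / k%:R : K).
  apply: sin_gt0_pi; rewrite divr_gt0 //= ltr_pdivrMr // ltr_pMr //.
  by rewrite ltr1n.
rewrite -(pmulr_lge0 _ s0) cheb_sin; apply: sin_ge0_pi.
rewrite mulr_ge0 ?divr_ge0 ?ler0n ?(ltW pi0) //= mulrCA ger_pMr //.
by rewrite ler_pdivrMr // mul1r ler_nat.
Qed.

End ChebyshevU.

(** * Alternating words, length, and positivity of roots *)

Section Tits.
Local Open Scope group_scope.
Variables (S : finType) (W : groupType) (sigma : S -> W).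
Hypothesis sigma2 : forall s, sigma s * sigma s = 1.
Hypothesis sigma_gen : forall g, exists u : seq S, g = \prod_(s <- u) sigma s.

Let mulWA (x y z : W) : x * (y * z) = x * y * z := mulgA x y z.

(** Positions are counted from the right, starting at 0 with [t]: this is the letter to put in front
    of [n] letters. *)
Definition alt_letter (s t : S) (n : nat) : S := if odd n then s else t.

(* ends (on the right) with the letter [t] *)
Fixpoint alt_prod (s t : S) (n : nat) : W :=
  if n is n'.+1 then sigma (alt_letter s t n') * alt_prod s t n' else 1.

Lemma alt_letterS s t n : alt_letter s t n.+1 = alt_letter t s n.
Proof. by rewrite /alt_letter /=; case: (odd n). Qed.

Lemma alt_prodSr s t n : alt_prod s t n.+1 = alt_prod t s n * sigma t.
Proof.
elim: n => [|n IH]; first by rewrite /= mul1g mulg1.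
rewrite [LHS]/= -/(alt_prod s t n.+1) IH alt_letterS mulWA //.
Qed.

Lemma sigmaV s : (sigma s)^-1 = sigma s.
Proof. by apply: (mulgI (sigma s)); rewrite mulgV sigma2. Qed.

Lemma alt_prod_double s t k : alt_prod s t k.*2 = (sigma s * sigma t) ^+ k.
Proof.
elim: k => [|k IH] //=.
by rewrite IH /alt_letter /= odd_double /= expgS mulWA.
Qed.

(** The inverse of a word ending in [s] begins with [s], so the concatenation still alternates; the
    parity of [i] decides its last letter. *)
Lemma alt_prod_divr s t k i :
  alt_prod s t k * (alt_prod t s i)^-1 =
  if odd i then alt_prod t s (k + i) else alt_prod s t (k + i).
Proof.
elim: i s t k => [|i IH] s t k; first by rewrite /= invg1 mulg1 addn0.
rewrite alt_prodSr invgM sigmaV mulWA -alt_prodSr IH addSnnS /=.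
by case: (odd i).
Qed.

(** The quotient of the two sides is an alternating word of length 2k, hence a k-th power of one of
    the two products of generators. *)
Lemma alt_prod_braid s t k :
  (sigma s * sigma t) ^+ k = 1 -> alt_prod s t k = alt_prod t s k.
Proof.
move=> stk; have tsk : (sigma t * sigma s) ^+ k = 1.
  by rewrite -[sigma t]sigmaV -[sigma s]sigmaV -invgM expVgn stk invg1.
have := alt_prod_divr s t k k; rewrite addnn !alt_prod_double stk tsk if_same.
by move/(congr1 (fun x => x * alt_prod t s k)); rewrite mulgVK mul1g.
Qed.

Lemma exists_word g : exists n,
  `[< exists u : seq S, size u = n /\ g = \prod_(s <- u) sigma s >].
Proof.
by have [u ->] := sigma_gen g; exists (size u); apply/asboolP; exists u.
Qed.

Definition cox_length g : nat := ex_minn (exists_word g).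

Lemma cox_length_word g :
  exists2 u : seq S, size u = cox_length g & g = \prod_(s <- u) sigma s.
Proof.
by rewrite /cox_length; case: ex_minnP => n /asboolP[u [su gu]] _; exists u.
Qed.

Lemma cox_length_prod (u : seq S) :
  (cox_length (\prod_(s <- u) sigma s) <= size u)%N.
Proof.
by rewrite /cox_length; case: ex_minnP => n _; apply; apply/asboolP; exists u.
Qed.

Lemma cox_lengthM g h : (cox_length (g * h) <= cox_length g + cox_length h)%N.
Proof.
have [u <- {1}->] := cox_length_word g; have [v <- {1}->] := cox_length_word h.
by rewrite -big_cat -size_cat cox_length_prod.
Qed.

Lemma cox_length_gen s : (cox_length (sigma s) <= 1)%N.
Proof. by have := cox_length_prod [:: s]; rewrite big_seq1. Qed.

Lemma cox_length_alt s t n : (cox_length (alt_prod s t n) <= n)%N.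
Proof.
elim: n => [|n IH]; first by have := cox_length_prod [::]; rewrite big_nil.
by rewrite /= (leq_trans (cox_lengthM _ _)) // -add1n leq_add // cox_length_gen.
Qed.

Lemma cox_length_last g : g != 1 ->
  exists h s, g = h * sigma s /\ (cox_length h < cox_length g)%N.
Proof.
have [u su {1 2}->] := cox_length_word g.
case/lastP: u su => [|u s] su; first by rewrite big_nil eqxx.
move=> _; exists (\prod_(i <- u) sigma i), s; split; last first.
  by rewrite -su size_rcons ltnS cox_length_prod.
by rewrite -cats1 big_cat big_seq1.
Qed.

(** By the braid relation the last [k] letters can be rewritten to end in [s], which then
    cancels. *)
Lemma alt_prod_descent s t k n :
  (sigma s * sigma t) ^+ k = 1 -> (0 < k <= n)%N ->
  (cox_length (alt_prod s t n * sigma s) < n)%N.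
Proof.
move=> stk /andP[k0]; elim: n => [|n IH]; first by lia.
rewrite leq_eqVlt => /predU1P[kn|kn].
  rewrite -kn (alt_prod_braid stk) kn alt_prodSr -mulWA sigma2 mulg1 ltnS.
  exact: cox_length_alt.
rewrite /= -mulWA; apply: leq_ltn_trans (cox_lengthM _ _) _.
by have := IH kn; have := cox_length_gen (alt_letter s t n); lia.
Qed.

Section Representation.
Local Open Scope ring_scope.
Variables (F : realDomainType) (m : coxeterMatrix S) (B : S -> S -> F).
Hypothesis sigma_rel : forall s t k, m s t = Some k ->
  ((sigma s * sigma t) ^+ k)%g = 1%g.
Hypothesis B_diag : forall s, B s s = 2.
Hypothesis B_sym : forall s t, B s t = B t s.
(** Phrased with [cheb] rather than cosines, so that it makes sense both over the integers and over
    the reals. *)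
Hypothesis B_fin : forall s t k n, s != t -> m s t = Some k -> (n <= k)%N ->
  0 <= cheb (- B s t) n.
Hypothesis B_inf : forall s t, s != t -> m s t = None -> B s t <= -2.

(* [M g x u] stands for the coefficient of [alpha_u] in [g alpha_x]. *)
Variable M : W -> S -> S -> F.
Hypothesis M1 : forall x u, M 1%g x u = (u == x)%:R.
Hypothesis M_gen : forall g p x u,
  M (g * sigma p)%g x u = M g x u - B p x * M g p u.

(** In rank two the coordinates of a root are consecutive quantum integers. The induction absorbs
    the leftmost letter into [v]. *)
Lemma M_alt v s t n u :
  M (v * alt_prod s t n)%g s u =
  cheb (- B s t) n.+1 * M v (alt_letter t s n) u +
  cheb (- B s t) n * M v (alt_letter s t n) u.
Proof.
elim: n v => [|n IH] v; first by rewrite mulg1 /alt_letter /= mul1r mul0r addr0.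
rewrite [alt_prod _ _ _]/= mulWA IH !M_gen !alt_letterS B_diag chebSS.
have -> : B (alt_letter s t n) (alt_letter t s n) = B s t.
  by rewrite /alt_letter; case: (odd n); rewrite // B_sym.
ring.
Qed.

(* Write g = v x with x alternating in s, t of maximal length compatible with
   l(g) = l(v) + l(x): neither s nor t shortens v, so that by induction v maps
   alpha_s and alpha_t to non-negative vectors, and x alpha_s is a non-negative
   combination of alpha_s and alpha_t. *)
Lemma root_ge0 g s u :
  (cox_length g <= cox_length (g * sigma s)%g)%N -> 0 <= M g s u.
Proof.
have [n] := ubnP (cox_length g); elim: n g s u => // n IH g s u.
rewrite ltnS => gn gs.
have [->|g1] := eqVneq g 1%g; first by rewrite M1 ler0n.
have [h [t [gh hg]]] := cox_length_last g1.
have st : s != t.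
  apply: contraTneq hg => est; rewrite -leqNgt (leq_trans gs) //.
  by rewrite gh est -mulWA sigma2 mulg1.
pose P j := `[< exists v, g = (v * alt_prod s t j)%g /\
                  (cox_length v + j = cox_length g)%N >].
have P1 : P 1%N.
  apply/asboolP; exists h; rewrite /= mulg1; split=> //.
  apply/eqP; rewrite eqn_leq addn1 hg /=.
  by rewrite gh -addn1 (leq_trans (cox_lengthM _ _)) // leq_add2l cox_length_gen.
have Pmax j : P j -> (j <= cox_length g)%N by move=> /asboolP[v [_ <-]]; lia.
case: (ex_maxnP (ex_intro (fun j => P j) 1%N P1) Pmax).
move=> j /asboolP[v [gv lv]] jmax.
have j1 : (1 <= j)%N by apply: jmax.
(* This letter would extend the alternating word on the left; if it shortened [v], then [j] would
   not be maximal. *)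
have vp : (cox_length v <= cox_length (v * sigma (alt_letter s t j))%g)%N.
  rewrite leqNgt; apply/negP => lt.
  suff /jmax : P j.+1 by rewrite ltnn.
  apply/asboolP; exists (v * sigma (alt_letter s t j))%g.
  have gE : g = (v * sigma (alt_letter s t j) * alt_prod s t j.+1)%g.
    by rewrite /= -mulWA (mulWA (sigma _)) sigma2 mul1g.
  split=> //.
  have := cox_lengthM (v * sigma (alt_letter s t j))%g (alt_prod s t j.+1).
  by rewrite -gE; have := cox_length_alt s t j.+1; lia.
(* This is the leftmost letter of the alternating word; if it shortened [v], moving it into [v]
   would make [g] too short. *)
have vq : (cox_length v <= cox_length (v * sigma (alt_letter t s j))%g)%N.
  rewrite leqNgt; apply/negP => lt.
  have gE : g = (v * sigma (alt_letter t s j) * alt_prod s t j.-1)%g.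
    rewrite gv -[in LHS](prednK j1) /= mulWA; congr (_ * sigma _ * _)%g.
    by rewrite -alt_letterS prednK.
  have := cox_lengthM (v * sigma (alt_letter t s j))%g (alt_prod s t j.-1).
  by rewrite -gE; have := cox_length_alt s t j.-1; lia.
(* For a finite label [k] the bound j < k holds: otherwise [alt_prod_descent] would make
   [g * sigma s] shorter than [g]. *)
have cheb0 i : (i <= j.+1)%N -> 0 <= cheb (- B s t) i.
  move=> ij; case mst : (m s t) => [k|]; last first.
    by apply: cheb_ge0; have := B_inf st mst; lra.
  apply: (B_fin st mst); apply: leq_trans ij _.
  rewrite ltnNge; apply/negP => kj.
  have := cox_offdiag st mst => k2.
  have := @alt_prod_descent s t k j (sigma_rel mst).
  rewrite kj andbT => /(_ (ltnW k2)).
  have := cox_lengthM v (alt_prod s t j * sigma s)%g.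
  by rewrite mulWA -gv => /(leq_trans gs); lia.
rewrite gv M_alt addr_ge0 // mulr_ge0 ?cheb0 ?IH //; lia.
Qed.

(** If g = h s with [h] shorter, then h alpha_s is non-negative, while g alpha_s = - h alpha_s would
    have to be alpha_s. *)
Lemma geometric_faithful g : (forall x u, M g x u = (u == x)%:R) -> g = 1%g.
Proof.
move=> Mg; apply/eqP; apply: contraT => g1.
have [h [s [gh hg]]] := cox_length_last g1.
have hs : (cox_length h <= cox_length (h * sigma s)%g)%N.
  by rewrite -gh ltnW.
have := root_ge0 s hs; have := Mg s s.
rewrite gh M_gen B_diag eqxx mulr1n; move: (M h s s) => z; lra.
Qed.

End Representation.
End Tits.

(** * Frobenius-Perron dimension *)

Section PerronFrobenius.
Local Open Scope ring_scope.
Import numFieldNormedType.Exports.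
Local Open Scope classical_set_scope.

Definition mxform (R : comPzRingType) n (P : 'M[R]_n) (u v : 'rV[R]_n) : R :=
  (u *m P *m v^T) 0 0.

Lemma mxformE (R : comPzRingType) n (P : 'M[R]_n) u v :
  mxform P u v = \sum_i \sum_j u 0 i * P i j * v 0 j.
Proof.
rewrite /mxform exchange_big mxE; apply: eq_bigr => j _.
by rewrite !mxE mulr_suml.
Qed.

Lemma mxform1E (R : comPzRingType) n (u v : 'rV[R]_n) :
  mxform 1%:M u v = \sum_i u 0 i * v 0 i.
Proof. by rewrite /mxform mulmx1 mxE; under eq_bigr do rewrite mxE. Qed.

Lemma mxform_sym (R : comPzRingType) n (P : 'M[R]_n) u v :
  P^T = P -> mxform P u v = mxform P v u.
Proof.
move=> PT; rewrite !mxformE exchange_big; apply: eq_bigr => i _.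
apply: eq_bigr => j _; have -> : P j i = P i j by rewrite -{1}PT mxE.
ring.
Qed.

Lemma mxform1_ge0 (R : realDomainType) n (u : 'rV[R]_n) : 0 <= mxform 1%:M u u.
Proof. by rewrite mxform1E sumr_ge0 // => i _; rewrite -expr2 sqr_ge0. Qed.

Lemma mxform1_eq0 (R : realDomainType) n (u : 'rV[R]_n) :
  mxform 1%:M u u = 0 -> u = 0.
Proof.
rewrite mxform1E => /eqP; rewrite psumr_eq0 => [/allP u0|i _]; last first.
  by rewrite -expr2 sqr_ge0.
apply/rowP => i; rewrite mxE; apply/eqP.
by have := u0 i (mem_index_enum i); rewrite /= mulf_eq0 orbb.
Qed.

(** Otherwise a small move from [x] along - x P would make the form negative, its first-order term
    being -2t |xP|^2. *)
Lemma mxform_psd_ker (R : realFieldType) n (P : 'M[R]_n) (x : 'rV[R]_n) :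
  P^T = P -> (forall v, 0 <= mxform P v v) -> mxform P x x = 0 -> x *m P = 0.
Proof.
move=> PT P0 Pxx; apply: mxform1_eq0; set z := x *m P.
have xz : mxform P x z = mxform 1%:M z z by rewrite /mxform -/z mulmx1.
have expand t : mxform P (x - t *: z) (x - t *: z) =
    - (2 * t) * mxform 1%:M z z + t ^+ 2 * mxform P z z.
  have -> : mxform P (x - t *: z) (x - t *: z) = mxform P x x
      - t * mxform P x z - t * mxform P z x + t ^+ 2 * mxform P z z.
    have -> : mxform P = fun u v => (u *m P *m v^T) 0 0 by [].
    have -> : (x - t *: z)^T = x^T - t *: z^T by rewrite linearB linearZ.
    rewrite !mulmxBl !mulmxBr -!scalemxAl -!scalemxAr !mxE.
    ring.
  by rewrite Pxx (mxform_sym z x) // xz; ring.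
apply/eqP; rewrite eq_le mxform1_ge0 andbT leNgt; apply/negP => zz.
have Pzz := P0 z.
(* Adding 1 keeps the denominator positive and gives t P(z,z) < |z|^2. *)
pose t := mxform 1%:M z z / (mxform P z z + 1).
have t0 : 0 < t by rewrite divr_gt0 // ltr_wpDl.
have := P0 (x - t *: z); rewrite expand.
have : t * (mxform P z z + 1) = mxform 1%:M z z.
  by rewrite /t divfK // gt_eqF // ltr_wpDl.
nra.
Qed.

Lemma mxform_continuous (K : realType) n (P : 'M[K]_n) :
  continuous (fun v => mxform P v v).
Proof.
have -> : (fun v : 'rV[K]_n => mxform P v v) =
    (fun v => \sum_i \sum_j v 0 i * P i j * v 0 j).
  by apply/funext => v; exact: mxformE.
have add_cont := @add_continuous K^o.
apply: continuous_big => // i _; apply: continuous_big => // j _ v.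
have cvg_coord k : (w 0 k : K) @[w --> v] --> (v 0 k : K).
  exact: coord_continuous.
exact: cvgM (cvgMr_tmp (b := P i j) (cvg_coord i)) (cvg_coord j).
Qed.

(** The form attains its maximum on the compact unit sphere; homogeneity extends the bound to all
    vectors. *)
Lemma mxform_max (K : realType) n (A : 'M[K]_n.+1) :
  exists2 x : 'rV[K]_n.+1, mxform 1%:M x x = 1 &
    forall v, mxform A v v <= mxform A x x * mxform 1%:M v v.
Proof.
pose D := [set v : 'rV[K]_n.+1 | mxform 1%:M v v = 1].
have D0 : D !=set0.
  exists (delta_mx 0 0); rewrite /D /= mxform1E (bigD1 0) //= big1 => [|i i0].
    by rewrite !mxE /= mulr1 addr0.
  by rewrite !mxE /= (negPf i0) mulr0.
have Dcl : closed D.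
  have -> : D = (fun v => mxform 1%:M v v) @^-1` [set 1] by [].
  apply: preimage_closed => [v _|]; [exact: mxform_continuous|exact: closed_eq].
have Dbd : bounded_set D.
  exists 1; split; first exact: num_real.
  move=> M M1 v Dv; apply: le_trans (ltW M1).
  (* The matrix norm is the largest absolute value of an entry, and the square of each entry is one
     term of [mxform 1%:M v v], which is 1. *)
  rewrite [leLHS]/Num.norm /= mx_normrE.
  apply/bigmax_leP; split=> //= -[i j] _ /=.
  rewrite [i]ord1 -(@ler_pXn2r _ 2) ?nnegrE // expr1n -normrX.
  rewrite ger0_norm ?sqr_ge0 //.
  rewrite -Dv mxform1E (bigD1 j) //= -expr2 lerDl sumr_ge0 // => k _.
  by rewrite -expr2 sqr_ge0.
have [x xD xmax] := compact_EVT_max D0 (bounded_closed_compact Dbd Dcl)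
  (continuous_subspaceT (@mxform_continuous K n.+1 A)).
exists x => [|v]; first by move: xD; rewrite inE.
have [v0|] := eqVneq (mxform 1%:M v v) 0.
  by rewrite v0 mulr0 (mxform1_eq0 v0) /mxform mul0mx mul0mx mxE.
move=> vv; have {}vv : 0 < mxform 1%:M v v by rewrite lt0r vv mxform1_ge0.
pose r := Num.sqrt (mxform 1%:M v v); have r2 : r ^+ 2 = mxform 1%:M v v.
  by rewrite sqr_sqrtr // ltW.
have r0 : 0 < r by rewrite sqrtr_gt0.
have scaled P : mxform P (r^-1 *: v) (r^-1 *: v) = mxform P v v / r ^+ 2.
  by rewrite /mxform linearZ /= -!scalemxAl -scalemxAr !mxE expr2 invfM; ring.
have := xmax (r^-1 *: v).
rewrite inE /D /= !scaled r2 divff ?gt_eqF // => /(_ erefl).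
by rewrite ler_pdivrMr.
Qed.

(* Passing to absolute values does not decrease the quadratic form, so it
   preserves the [lam]-eigenspace; since [A] is positive, an eigenvector with a
   zero coordinate vanishes, which makes the eigenspace a line. *)
Lemma perron_frobenius_sym (K : realType) n (A : 'M[K]_n.+1) :
  A^T = A -> (forall i j, 0 < A i j) ->
  exists lam (x : 'rV[K]_n.+1), [/\ forall i, 0 < x 0 i, x *m A = lam *: x &
    forall y, y *m A = lam *: y -> exists c, y = c *: x].
Proof.
move=> AT A0; have [x0 x01 xmax] := mxform_max A.
pose lam := mxform A x0 x0; exists lam; pose P := lam%:M - A.
have PE u v : mxform P u v = lam * mxform 1%:M u v - mxform A u v.
  by rewrite /mxform mulmxBr mulmxBl mul_mx_scalar mulmx1 -scalemxAl !mxE.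
have PT : P^T = P by rewrite /P linearB /= tr_scalar_mx AT.
have P0 v : 0 <= mxform P v v by rewrite PE subr_ge0.
(* [P] is positive semidefinite, so its isotropic vectors form its kernel, the [lam]-eigenspace. *)
have eigP y : (y *m A = lam *: y) <-> mxform P y y = 0.
  split=> [yA|/(mxform_psd_ker PT P0)].
    by rewrite PE /mxform yA mulmx1 -scalemxAl !mxE subrr.
  by rewrite /P mulmxBr mul_mx_scalar => /subr0_eq.
pose absv (y : 'rV[K]_n.+1) := map_mx (fun a : K => `|a|) y.
have absP y : y *m A = lam *: y -> absv y *m A = lam *: absv y.
  move=> /eigP; rewrite PE => /subr0_eq yA; apply/eigP.
  apply/eqP; rewrite eq_le P0 andbT PE subr_le0.
  have -> : mxform 1%:M (absv y) (absv y) = mxform 1%:M y y.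
    rewrite !mxform1E; apply: eq_bigr => i _.
    by rewrite !mxE -normrM ger0_norm // -expr2 sqr_ge0.
  rewrite yA !mxformE; apply: ler_sum => i _; apply: ler_sum => j _.
  by rewrite !mxE (le_trans (ler_norm _)) // !normrM (gtr0_norm (A0 i j)).
have posP y : y *m A = lam *: y -> y != 0 -> forall i, 0 < absv y 0 i.
  move=> yA y0 i; rewrite mxE normr_gt0; apply/negP => /eqP yi.
  have /matrixP /(_ 0 i) := absP _ yA; rewrite !mxE yi normr0 mulr0.
  move/eqP; rewrite psumr_eq0 => [/allP s0|j _]; last first.
    by rewrite !mxE mulr_ge0 // ltW.
  case/negP: y0; apply/eqP/rowP => j; have := s0 j (mem_index_enum j).
  by rewrite !mxE /= mulf_eq0 (gt_eqF (A0 j i)) orbF normr_eq0 => /eqP.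
have x0A : x0 *m A = lam *: x0 by apply/eigP; rewrite PE x01 mulr1 subrr.
have x0n : x0 != 0.
  apply: contra_eq_neq x01 => ->.
  by rewrite /mxform mul0mx mul0mx mxE eq_sym oner_eq0.
exists (absv x0); split; [exact: posP | exact: absP |].
(* The scalar makes the difference vanish at coordinate 0, which [posP] forbids for a non-zero
   eigenvector. *)
move=> y yA; exists (y 0 0 / absv x0 0 0).
set z := (X in _ = X); apply/eqP; rewrite -subr_eq0; apply/negPn/negP => yz0.
have yzA : (y - z) *m A = lam *: (y - z).
  by rewrite mulmxBl yA -scalemxAl (absP _ x0A) scalerBr !scalerA mulrC.
have := posP _ yzA yz0 0; rewrite [_ 0 0]mxE normr_gt0.
rewrite [_ 0 0]mxE [(- z) 0 0]mxE [z 0 0]mxE.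
by rewrite divfK ?subrr ?eqxx // gt_eqF // posP.
Qed.

End PerronFrobenius.

(** * [FPdim] as a ring homomorphism invariant under the involution *)

Section FrobeniusPerron.
Local Open Scope ring_scope.
Variables (K : realType) (R : fusionRing).
Notation b := (@fr_basis R).
Notation coord := (@fr_coord R).
Notation n := (fr_rank R).

Lemma fr_coord_mull x y l :
  coord (x * y) l = \sum_i coord x i * coord (b i * y) l.
Proof.
rewrite -{1}(fr_coordK x) mulr_suml fr_coord_big; apply: eq_bigr => i _.
by rewrite mulrzAl fr_coord_mulz mulrC.
Qed.

Lemma fr_coord_mulr x y l :
  coord (x * y) l = \sum_i coord y i * coord (x * b i) l.
Proof.
rewrite -{1}(fr_coordK y) mulr_sumr fr_coord_big; apply: eq_bigr => i _.
by rewrite mulrzAr fr_coord_mulz mulrC.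
Qed.

Lemma fr_nonneg_mul (x y : R) : fr_nonneg x -> fr_nonneg y -> fr_nonneg (x * y).
Proof.
move=> x0 y0 l; rewrite fr_coord_mull sumr_ge0 // => i _; rewrite mulr_ge0 //.
by rewrite fr_coord_mulr sumr_ge0 // => j _; rewrite mulr_ge0 // fr_mul_ge0.
Qed.

Lemma fr_nonneg_basis j : fr_nonneg (b j).
Proof. by move=> i; rewrite fr_coord_basis ler0n. Qed.

Lemma fr_tauC x y : coord (x * y) ord0 = coord (y * x) ord0.
Proof.
rewrite fr_coord_mull [RHS]fr_coord_mulr; apply: eq_bigr => i _; congr (_ * _).
rewrite fr_coord_mulr [RHS]fr_coord_mull; apply: eq_bigr => j _; congr (_ * _).
by rewrite !fr_coef1 eq_sym (canF_eq (@fr_dualK R)).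
Qed.

Lemma fr_coord_inj x y : (forall i, coord x i = coord y i) -> x = y.
Proof.
move=> xy; rewrite -(fr_coordK x) -(fr_coordK y).
by apply: eq_bigr => i _; rewrite xy.
Qed.

(* In row coordinates with respect to the basis, [u *m lmul_mx x] and
   [u *m rmul_mx x] are the products [x u] and [u x]. *)
Definition lmul_mx (x : R) : 'M[K]_n.+1 :=
  \matrix_(k, l) (coord (x * b k) l)%:~R.
Definition rmul_mx (x : R) : 'M[K]_n.+1 :=
  \matrix_(k, l) (coord (b k * x) l)%:~R.

Lemma lmul_mxM x y : lmul_mx (x * y) = lmul_mx y *m lmul_mx x.
Proof.
apply/matrixP => k l; rewrite !mxE -mulrA fr_coord_mulr rmorph_sum.
by apply: eq_bigr => i _; rewrite !mxE rmorphM.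
Qed.

Lemma lmul_mx1 : lmul_mx 1 = 1%:M.
Proof.
by apply/matrixP => k l; rewrite !mxE mul1r fr_coord_basis eq_sym; case: eqP.
Qed.

Lemma lmul_mx_coord x : lmul_mx x = \sum_i (coord x i)%:~R *: fr_mx K i.
Proof.
apply/matrixP => k l; rewrite !mxE fr_coord_mull rmorph_sum summxE.
by apply: eq_bigr => i _; rewrite !mxE rmorphM.
Qed.

Lemma lmul_rmul_mxC x y : lmul_mx x *m rmul_mx y = rmul_mx y *m lmul_mx x.
Proof.
apply/matrixP => k l; rewrite !mxE.
transitivity ((coord (x * b k * y) l)%:~R : K).
  rewrite fr_coord_mull rmorph_sum; apply: eq_bigr => i _.
  by rewrite !mxE rmorphM.
rewrite -mulrA fr_coord_mulr rmorph_sum.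
by apply: eq_bigr => i _; rewrite !mxE rmorphM.
Qed.

Lemma rmul_mx_star x : rmul_mx (fr_star R x) = (rmul_mx x)^T.
Proof. by apply/matrixP => k l; rewrite !mxE fr_coord_mul_star. Qed.

(** Chosen because its right multiplication is both symmetric and entrywise positive. *)
Definition fr_total : R := \sum_j b j.

Lemma fr_total_star : fr_star R fr_total = fr_total.
Proof.
rewrite /fr_total raddf_sum (reindex_inj (inv_inj (@fr_dualK R))) /=.
by apply: eq_bigr => j _; rewrite fr_star_basis fr_dualK.
Qed.

(* The coefficient of [b_l] in [b_k b_j] is that of [b_j^*] in [b_l^* b_k],
   which is non-zero. *)
Lemma rmul_mx_total_gt0 k l : 0 < rmul_mx fr_total k l.
Proof.
rewrite mxE ltr0z /fr_total mulr_sumr fr_coord_big.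
have [i ci] : exists i, coord (b (fr_dual l) * b k) i != 0.
  apply/existsP; apply: contraT; rewrite negb_exists => /forallP c0.
  case/negP: (fr_mul_neq0 (fr_dual l) k); apply/eqP/fr_coord_inj => i.
  by rewrite fr_coord0; apply/eqP; have := c0 i; rewrite negbK.
have cE : coord (b k * b (fr_dual i)) l = coord (b (fr_dual l) * b k) i.
  by rewrite fr_coord_tau [RHS]fr_coord_tau fr_tauC mulrA.
rewrite (bigD1 (fr_dual i)) //= ltr_pwDl // ?cE ?lt0r ?ci ?fr_mul_ge0 //.
by rewrite sumr_ge0 // => j _; rewrite fr_mul_ge0.
Qed.

(** Left multiplications commute with right multiplication by [fr_total], hence preserve its
    Perron-Frobenius line. *)
Lemma common_eigenvector : exists x : 'rV[K]_n.+1,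
  (forall i, 0 < x 0 i) /\ forall r, exists c, x *m lmul_mx r = c *: x.
Proof.
have sym : (rmul_mx fr_total)^T = rmul_mx fr_total.
  by rewrite -rmul_mx_star fr_total_star.
have [lam [x [x0 xT uniq_x]]] := perron_frobenius_sym sym rmul_mx_total_gt0.
exists x; split=> // r; apply: uniq_x.
by rewrite -mulmxA lmul_rmul_mxC mulmxA xT scalemxAl.
Qed.

Section Eigenvector.
Variable x : 'rV[K]_n.+1.
Hypothesis x_gt0 : forall i, 0 < x 0 i.
Hypothesis x_eig : forall r, exists c, x *m lmul_mx r = c *: x.

Definition eig_char r : K := (x *m lmul_mx r) 0 0 / x 0 0.

Lemma eig_charP r : x *m lmul_mx r = eig_char r *: x.
Proof.
rewrite /eig_char; have [c ->] := x_eig r.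
by rewrite mxE mulfK // gt_eqF.
Qed.

Lemma eig_char_unique r c : x *m lmul_mx r = c *: x -> c = eig_char r.
Proof. by rewrite /eig_char => ->; rewrite mxE mulfK // gt_eqF. Qed.

Lemma eig_charM r s : eig_char (r * s) = eig_char r * eig_char s.
Proof.
apply/esym/eig_char_unique; rewrite lmul_mxM mulmxA eig_charP -scalemxAl.
by rewrite eig_charP scalerA mulrC.
Qed.

Lemma eig_char1 : eig_char 1 = 1.
Proof. by apply/esym/eig_char_unique; rewrite lmul_mx1 mulmx1 scale1r. Qed.

Lemma eig_char_basis j : x *m fr_mx K j = eig_char (b j) *: x.
Proof.
by rewrite -eig_charP; congr (_ *m _); apply/matrixP => k l; rewrite !mxE.
Qed.

Lemma eig_charE r : eig_char r = \sum_i (coord r i)%:~R * eig_char (b i).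
Proof.
apply/esym/eig_char_unique; rewrite lmul_mx_coord mulmx_sumr scaler_suml.
by apply: eq_bigr => i _; rewrite -scalemxAr eig_char_basis scalerA.
Qed.

Lemma eig_char_basis_ge0 j : 0 <= eig_char (b j).
Proof.
rewrite /eig_char divr_ge0 // ?(ltW (x_gt0 0)) // mxE sumr_ge0 // => i _.
by rewrite mxE mulr_ge0 ?(ltW (x_gt0 i)) // ler0z fr_mul_ge0.
Qed.

(** The product of b_j and its dual contains 1, so its character value is at least 1 and cannot be
    0. *)
Lemma eig_char_basis_gt0 j : 0 < eig_char (b j).
Proof.
rewrite lt0r eig_char_basis_ge0 andbT; apply/eqP => j0.
have := eig_charM (b j) (b (fr_dual j)); rewrite j0 mul0r eig_charE.
move/eqP; rewrite psumr_eq0 => [/allP /(_ ord0 (mem_index_enum _))|i _]; last first.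
  by rewrite mulr_ge0 ?eig_char_basis_ge0 // ler0z fr_mul_ge0.
by rewrite /= fr_coef1 eqxx fr_basis1 eig_char1 mulr1 oner_eq0.
Qed.

(** The values of [eig_char] on the basis form a positive right eigenvector of [fr_mx K j]. Using
    them as weights in an l1 norm, the triangle inequality bounds every eigenvalue. *)
Lemma eigenvalue_le_eig_char j a :
  0 <= a -> eigenvalue (fr_mx K j) a -> a <= eig_char (b j).
Proof.
move=> a0 /eigenvalueP[v va v0].
pose N := \sum_k `|v 0 k| * eig_char (b k).
have [k vk] : exists k, v 0 k != 0.
  apply/existsP; apply: contraNT v0; rewrite negb_exists => /forallP v0.
  by apply/eqP/rowP => k; rewrite mxE; apply/eqP; have := v0 k; rewrite negbK.
have N0 : 0 < N.
  rewrite /N (bigD1 k) //= ltr_pwDl //.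
    by rewrite mulr_gt0 ?normr_gt0 // eig_char_basis_gt0.
  by rewrite sumr_ge0 // => i _; rewrite mulr_ge0 // eig_char_basis_ge0.
rewrite -(ler_pM2r N0) /N !mulr_sumr.
have charM i : eig_char (b j) * (`|v 0 i| * eig_char (b i)) =
    \sum_l `|v 0 i| * (fr_mx K j i l * eig_char (b l)).
  rewrite mulrCA -eig_charM eig_charE mulr_sumr.
  by apply: eq_bigr => l _; rewrite mxE.
under [leRHS]eq_bigr do rewrite charM.
rewrite exchange_big /=; apply: ler_sum => l _.
under eq_bigr do rewrite mulrA.
rewrite -mulr_suml mulrA ler_wpM2r ?eig_char_basis_ge0 //.
rewrite -[X in X * _](ger0_norm a0) -normrM.
have /matrixP /(_ 0 l) := va; rewrite !mxE => <-.
apply: le_trans (ler_norm_sum _ _ _) _; apply: ler_sum => i _.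
have M0 : 0 <= fr_mx K j i l by rewrite mxE ler0z fr_mul_ge0.
by rewrite normrM (ger0_norm M0).
Qed.

(** The upper bound is attained at the eigenvector [x], so the supremum is a maximum. *)
Lemma FPdim_basisE j : FPdim_basis K j = eig_char (b j).
Proof.
set E := [set a : K | 0 <= a /\ eigenvalue (fr_mx K j) a]%classic.
have Ej : E (eig_char (b j)).
  split; first exact: eig_char_basis_ge0.
  apply/eigenvalueP; exists x; first exact: eig_char_basis.
  apply/eqP => /matrixP /(_ 0 0); rewrite mxE => x0.
  by have := x_gt0 0; rewrite x0 ltxx.
have ubE : ubound E (eig_char (b j)).
  by move=> a [a0 aE]; exact: eigenvalue_le_eig_char.
apply/eqP; rewrite eq_le; apply/andP; split.
  by apply: ge_sup => //; exists (eig_char (b j)).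
by apply: ub_le_sup => //; exists (eig_char (b j)).
Qed.

Lemma FPdimE r : FPdim K r = eig_char r.
Proof.
by rewrite eig_charE; apply: eq_bigr => i _; rewrite FPdim_basisE.
Qed.

End Eigenvector.

Lemma FPdimM : {morph FPdim K (R := R) : r s / r * s}.
Proof.
have [x [x0 xe]] := common_eigenvector.
by move=> r s; rewrite !(FPdimE x0 xe) eig_charM.
Qed.

Lemma FPdim1 : FPdim K (1 : R) = 1.
Proof.
by have [x [x0 xe]] := common_eigenvector; rewrite (FPdimE x0 xe) eig_char1.
Qed.

Lemma FPdimB : {morph FPdim K (R := R) : r s / r - s}.
Proof.
move=> r s; rewrite /FPdim -sumrB; apply: eq_bigr => i _.
by rewrite fr_coordD fr_coordN rmorphB mulrBl.
Qed.

HB.instance Definition _ := GRing.isZmodMorphism.Build R K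
  (FPdim K (R := R)) FPdimB.
HB.instance Definition _ := GRing.isMonoidMorphism.Build R K
  (FPdim K (R := R)) (conj FPdim1 FPdimM).

Lemma FPdim_basis_gt0 j : 0 < FPdim K (b j).
Proof.
have [x [x0 xe]] := common_eigenvector.
by rewrite (FPdimE x0 xe) eig_char_basis_gt0.
Qed.

Lemma FPdim_coord r : FPdim K r = \sum_i (coord r i)%:~R * FPdim K (b i).
Proof.
rewrite -{1}(fr_coordK r) rmorph_sum; apply: eq_bigr => i _.
by rewrite raddfMz mulrzl.
Qed.

(* Right multiplication by [star r] is the transpose of right multiplication by
   [r], and both have the vector of dimensions as an eigenvector. *)
Lemma FPdim_star r : FPdim K (fr_star R r) = FPdim K r.
Proof.
pose N := \sum_i FPdim K (b i) ^+ 2.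
have N0 : 0 < N.
  rewrite /N (bigD1 ord0) //= ltr_pwDl ?exprn_gt0 ?FPdim_basis_gt0 //.
  by rewrite sumr_ge0 // => i _; rewrite sqr_ge0.
have FE s : N * FPdim K s =
    \sum_i \sum_j FPdim K (b i) * (coord (b i * s) j)%:~R * FPdim K (b j).
  rewrite mulr_suml; apply: eq_bigr => i _.
  rewrite expr2 -mulrA -FPdimM [FPdim K (_ * _)]FPdim_coord mulr_sumr.
  by apply: eq_bigr => j _; rewrite mulrA.
apply: (mulfI (lt0r_neq0 N0)); rewrite !FE exchange_big.
apply: eq_bigr => j _; apply: eq_bigr => i _.
by rewrite fr_coord_mul_star; ring.
Qed.

End FrobeniusPerron.

(** * Unfolding *)

Section CoxeterGroups.
Local Open Scope group_scope.
Variables (S : finType) (m : coxeterMatrix S).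

Lemma eval_word_relator (G : groupType) (f : S -> G) s t k :
  eval_word f (flatten (nseq k [:: (s, true); (t, true)])) = (f s * f t) ^+ k.
Proof.
elim: k => [|k IH]; first by rewrite /eval_word big_nil.
by rewrite expgS -IH /eval_word /= !big_cons mulgA.
Qed.

Lemma cox_gen_rel s t k :
  m s t = Some k -> (cox_gen m s * cox_gen m t) ^+ k = 1.
Proof.
by move=> mst; rewrite -eval_word_relator; apply: pres_gen_rel; exists s, t, k.
Qed.

Lemma cox_gen2 s : cox_gen m s * cox_gen m s = 1.
Proof. by rewrite -[LHS]expg1 (cox_gen_rel (cox_diag m s)). Qed.

Lemma cox_class_cons s c u :
  pres_class (coxeter_relator m) ((s, c) :: u) = cox_gen m s * pres_class _ u.
Proof.
have -> : pres_class (coxeter_relator m) ((s, c) :: u) =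
    (if c then cox_gen m s else (cox_gen m s)^-1) * pres_class _ u.
  by case: c; rewrite /cox_gen ?[_^-1]pres_invE [RHS]pres_mulE.
by case: c => //; rewrite (sigmaV cox_gen2).
Qed.

Lemma cox_gen_word g : exists u : seq S, g = \prod_(s <- u) cox_gen m s.
Proof.
have [u ->] := pres_classK g; exists (unzip1 u).
by elim: u => [|[s c] u IH]; rewrite ?big_nil // cox_class_cons IH /= big_cons.
Qed.

Lemma cox_ind (P : coxeter_group m -> Prop) :
  P 1 -> (forall s g, P g -> P (cox_gen m s * g)) -> forall g, P g.
Proof.
move=> P1 PS g; have [u ->] := cox_gen_word g.
by elim: u => [|s u IH]; rewrite ?big_nil // big_cons; apply: PS.
Qed.

End CoxeterGroups.

(** * Reflection action for off-diagonal labels 2, 3 and infinity *)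

Section SimplyLacedReflections.
Local Open Scope ring_scope.
Local Open Scope quotient_scope.
Variables (T : finType) (m : coxeterMatrix T) (F : comPzRingType).
Variable (C : T -> T -> F).
Hypothesis C_diag : forall p, C p p = 2.
Hypothesis C_sym : forall p q, C p q = C q p.
Hypothesis C_rel : forall p q k, p != q -> m p q = Some k ->
  (C p q = 0 /\ k = 2%N) \/ (C p q = -1 /\ k = 3%N).

Definition root_pairing (p : T) (f : T -> F) : F := \sum_x C p x * f x.

(** Here [f] lists coordinates with respect to the simple roots, and only the one at [p] changes. *)
Definition reflection (p : T) (f : T -> F) : T -> F :=
  fun q => f q - (q == p)%:R * root_pairing p f.

Lemma reflectionE p f q :
  reflection p f q = f q - (q == p)%:R * root_pairing p f.
Proof. by []. Qed.

Lemma root_pairing_delta p x : root_pairing p (fun q => (q == x)%:R) = C p x.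
Proof.
rewrite /root_pairing (bigD1 x) //= eqxx mulr1 big1 ?addr0 // => i /negPf ->.
by rewrite mulr0.
Qed.

Lemma root_pairing_refl q p f :
  root_pairing q (reflection p f) = root_pairing q f - C q p * root_pairing p f.
Proof.
rewrite -(root_pairing_delta q p) /root_pairing mulr_suml -sumrB.
by apply: eq_bigr => x _; rewrite /reflection mulrBr mulrA.
Qed.

(** Signs of letters are dropped because reflections are involutions. *)
Definition word_act (u : seq (T * bool)) (f : T -> F) : T -> F :=
  foldr (fun pc => reflection pc.1) f u.

(** The labels being 1, 2 or 3, a relator has at most six letters; expanding the pairings leaves a
    polynomial identity. *)
Lemma word_act_relator u f : coxeter_relator m u -> word_act u f = f.
Proof.
move=> [p [q [k [mpq ->]]]]; apply/funext => x.
have [epq|pq] := eqVneq p q.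
  move: mpq; rewrite epq cox_diag => -[<-].
  by rewrite /word_act /= !(reflectionE, root_pairing_refl) C_diag; ring.
case: (C_rel pq mpq) => -[Cpq ->]; have Cqp := Cpq; rewrite C_sym in Cqp;
  rewrite /word_act /= !(reflectionE, root_pairing_refl) !C_diag Cpq Cqp; ring.
Qed.

Lemma word_act_pres_eq u v : pres_eq (coxeter_relator m) u v ->
  forall f, word_act u f = word_act v f.
Proof.
elim=> {u v} [//|u v _ IH|u v w _ IH1 _ IH2|u u' v v' _ IH1 _ IH2|p c|u ru] f.
- by rewrite IH.
- by rewrite IH1.
- by rewrite /word_act !foldr_cat -/(word_act v f) IH2; exact: IH1.
- apply/funext => x; rewrite /word_act /= !(reflectionE, root_pairing_refl).
  by rewrite C_diag; ring.
- exact: word_act_relator.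
Qed.

Definition cox_act (g : coxeter_group m) : (T -> F) -> T -> F :=
  word_act (repr (g : {eq_quot pres_equiv (coxeter_relator m)})).

Lemma cox_act_class u f : cox_act (pres_class _ u) f = word_act u f.
Proof. exact/word_act_pres_eq/pres_repr. Qed.

Lemma cox_act1 f : cox_act 1%g f = f.
Proof. exact: cox_act_class [::] f. Qed.

Lemma cox_act_gen p f : cox_act (cox_gen m p) f = reflection p f.
Proof. exact: cox_act_class. Qed.

Lemma cox_actM g h f : cox_act (g * h)%g f = cox_act g (cox_act h f).
Proof.
have [u ->] := pres_classK g; have [v ->] := pres_classK h.
by rewrite [(_ * _)%g]pres_mulE !cox_act_class /word_act foldr_cat.
Qed.

Lemma cox_actB g a f h :
  cox_act g (fun q => f q - a * h q) =
  fun q => cox_act g f q - a * cox_act g h q.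
Proof.
elim/cox_ind: g f h => [|p g IH] f h; first by rewrite !cox_act1.
rewrite !cox_actM IH !cox_act_gen; apply/funext => q; rewrite /reflection.
have -> : root_pairing p (fun q => cox_act g f q - a * cox_act g h q) =
    root_pairing p (cox_act g f) - a * root_pairing p (cox_act g h).
  by rewrite /root_pairing mulr_sumr -sumrB; apply: eq_bigr => x _; ring.
ring.
Qed.

End SimplyLacedReflections.

Section SimplyLacedFaithful.
Local Open Scope ring_scope.
Variables (T : finType) (m : coxeterMatrix T) (F : realDomainType).
Variable (C : T -> T -> F).
Hypothesis C_diag : forall p, C p p = 2.
Hypothesis C_sym : forall p q, C p q = C q p.
Hypothesis C_rel : forall p q k, p != q -> m p q = Some k ->
  (C p q = 0 /\ k = 2%N) \/ (C p q = -1 /\ k = 3%N).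
Hypothesis C_inf : forall p q, p != q -> m p q = None -> C p q <= -2.

Lemma cox_act_faithful (g : coxeter_group m) :
  (forall x, cox_act C g (fun q => (q == x)%:R) = fun q => (q == x)%:R) ->
  g = 1%g.
Proof.
move=> gid.
apply: (@geometric_faithful T (coxeter_group m) (cox_gen m) (@cox_gen2 T m)
  (@cox_gen_word T m) F m C (@cox_gen_rel T m) C_diag C_sym _ C_inf
  (fun g x u => cox_act C g (fun q => (q == x)%:R) u))
  => [p q k n pq mpq|x u|h p x u|x u].
(* The values of [cheb] up to the label are 0, 1, 0 for entry 0 and 0, 1, 1, 0 for entry -1. *)
- case: (C_rel pq mpq) => -[-> ->]; case: n => [|[|[|[|//]]]] //= _;

    lra.
- by rewrite (cox_act1 C_diag C_sym C_rel).
- rewrite (cox_actM C_diag C_sym C_rel) (cox_act_gen C_diag C_sym C_rel).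
  have -> : reflection C p (fun q => (q == x)%:R) =
      (fun q => (q == x)%:R - C p x * (q == p)%:R).
    apply/funext => q.
    by rewrite /reflection root_pairing_delta [_ * C _ _]mulrC.
  by rewrite (cox_actB C_diag C_sym C_rel).
- by rewrite gid.
Qed.

End SimplyLacedFaithful.

(** * The unfolding homomorphism and its injectivity *)

Section Unfolding.
Local Open Scope ring_scope.
Variables (K : realType) (S : finType) (m : coxeterMatrix S) (R : fusionRing).
Variable L : geomRealisation K m R.
Notation b := (@fr_basis R).
Notation coord := (@fr_coord R).
Notation alpha := (simple_root R).
Notation form := (gr_form L).
Notation n := (fr_rank R).
Notation uact := (cox_act (m := unfolded L) (unfolded_r L)).

Lemma fr_star1 : fr_star R 1 = 1.
Proof. by rewrite -fr_basis1 fr_star_basis fr_dual0. Qed.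

Lemma free_module_sum (v : free_module R S) : v = \sum_t (v t : R) *: alpha t.
Proof.
apply/ffunP => u; rewrite sum_ffunE (bigD1 u) //= big1 => [|t tu].
  by rewrite !ffunE eqxx addr0 [RHS]mulr1.
by rewrite !ffunE eq_sym (negPf tu) [LHS]mulr0.
Qed.

Lemma gr_form_simple s (v : free_module R S) :
  form (alpha s) v = \sum_t (v t : R) * form (alpha s) (alpha t).
Proof.
have form0 : form (alpha s) 0 = 0.
  by apply: (addrI (form (alpha s) 0)); rewrite -gr_formDr !addr0.
rewrite {1}(free_module_sum v).
rewrite (big_morph _ (gr_formDr L (alpha s)) form0); apply: eq_bigr => t _.
by have := gr_formE L 1 (v t) s t; rewrite scale1r fr_star1 mulr1.
Qed.

(** One formula covers all cases since form(alpha_s, alpha_s) = 2. *)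
Lemma unfolded_rE p q :
  unfolded_r L p q = coord (b q.1 * form (alpha p.2) (alpha q.2)) p.1.
Proof.
rewrite /unfolded_r; case: p q => [i s] [j t]; rewrite xpair_eqE /= andbC.
case: eqVneq => //= ->.
rewrite gr_diag mulr_natr mulr2n fr_coordD fr_coord_basis.
by case: eqVneq.
Qed.

Lemma unfolded_r_diag p : unfolded_r L p p = 2.
Proof. by rewrite /unfolded_r eqxx. Qed.

Lemma unfolded_r_le0 p q : p != q -> unfolded_r L p q <= 0.
Proof.
move=> pq; rewrite /unfolded_r (negPf pq); case: eqVneq => // st.
have := fr_nonneg_mul (fr_nonneg_basis q.1) (gr_nonpos L st) p.1.
by rewrite mulrN fr_coordN oppr_ge0.
Qed.

Lemma unfolded_r_fin p q k : p != q -> unfolded L p q = Some k ->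
  (unfolded_r L p q = 0 /\ k = 2%N) \/ (unfolded_r L p q = -1 /\ k = 3%N).
Proof.
rewrite /= /unfolded_m => /negPf ->; case: eqP => [-> [<-]|_]; first by left.
by case: eqP => [-> [<-]|//]; right.
Qed.

Lemma unfolded_r_inf p q :
  p != q -> unfolded L p q = None -> unfolded_r L p q <= -2.
Proof.
move=> pq; have := unfolded_r_le0 pq; rewrite /= /unfolded_m (negPf pq).
move: (unfolded_r L p q) => r r0; case: eqP => // r1; case: eqP => // r2 _.
lia.
Qed.

Let uactM := cox_actM unfolded_r_diag (unfolded_r_sym L) unfolded_r_fin.
Let uact1 := cox_act1 unfolded_r_diag (unfolded_r_sym L) unfolded_r_fin.
Let uact_gen := cox_act_gen unfolded_r_diag (unfolded_r_sym L) unfolded_r_fin.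

(** Identifies R Lambda_S, as a Z-module, with the span of the simple roots of the unfolded
    system. *)
Definition unfold_coord (v : free_module R S) : unfolded_index S R -> int :=
  fun p => coord (v p.2) p.1.

Lemma unfold_coord_basis p :
  unfold_coord (b p.1 *: alpha p.2) = fun q => (q == p)%:R.
Proof.
apply/funext => -[j t]; case: p => i s.
rewrite /unfold_coord /= !ffunE xpair_eqE.
case: eqVneq => ts; rewrite ?andbF ?andbT.
  by rewrite [_ *: _]mulr1 fr_coord_basis.
by rewrite [_ *: _]mulr0 fr_coord0.
Qed.

(** Hence the reflections in all (i, s) together subtract the whole coefficient form(alpha_s, v) at
    alpha_s. *)
Lemma root_pairing_unfold_coord p v :
  root_pairing (unfolded_r L) p (unfold_coord v) =
  coord (form (alpha p.2) v) p.1.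
Proof.
rewrite gr_form_simple fr_coord_big /root_pairing.
under [RHS]eq_bigr do rewrite fr_coord_mull.
rewrite exchange_big pair_big /=; apply: eq_bigr => -[i t] _.
by rewrite unfolded_rE /unfold_coord /= mulrC.
Qed.

(* The reflections in the roots [(i, s)], for fixed [s], are pairwise orthogonal. *)
Lemma uact_prod_gens s (l : seq 'I_n.+1) f q : uniq l ->
  uact (\prod_(i <- l) cox_gen (unfolded L) (i, s))%g f q =
  f q - ((q.2 == s) && (q.1 \in l))%:R * root_pairing (unfolded_r L) q f.
Proof.
elim: l q => [|i l IH] q; first by rewrite big_nil uact1 andbF mul0r subr0.
rewrite big_cons uactM uact_gen /= => /andP[il ul]; rewrite reflectionE IH //.
have -> : root_pairing (unfolded_r L) (i, s)
    (uact (\prod_(j <- l) cox_gen (unfolded L) (j, s))%g f) =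
    root_pairing (unfolded_r L) (i, s) f.
  apply: eq_bigr => -[j t] _; rewrite IH //=.
  case: eqVneq => [->|_]; last by rewrite mul0r subr0.
  case: (boolP (j \in l)) => [jl|_]; last by rewrite mul0r subr0.
  suff -> : unfolded_r L (i, s) (j, s) = 0 by rewrite !mul0r.
  rewrite /unfolded_r xpair_eqE !eqxx andbT; case: eqVneq => // ij.
  by rewrite ij jl in il.
case: q => j t; rewrite xpair_eqE in_cons /=.
case: eqVneq => [->|_] /=; last by rewrite andbF !mul0r !subr0.
case: eqVneq => [->|_] /=; last by rewrite mul0r subr0.
by rewrite (negPf il) mul0r subr0.
Qed.

Lemma uact_unfolded_gens s v :
  uact (unfolded_gens L s) (unfold_coord v) =
  unfold_coord (v - form (alpha s) v *: alpha s).
Proof.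
apply/funext => -[j t]; rewrite uact_prod_gens ?index_enum_uniq //.
rewrite mem_index_enum andbT root_pairing_unfold_coord /unfold_coord /= !ffunE.
case: eqVneq => [->|_]; rewrite fr_coordD fr_coordN.
  by rewrite mul1r [_ *: _]mulr1.
by rewrite [_ *: _]mulr0 fr_coord0 mul0r.
Qed.

Section Representation.
Variable rho : coxeter_group m -> {linear free_module R S -> free_module R S}.
Hypothesis rho1 : forall v, rho 1%g v = v.
Hypothesis rhoM : forall g h v, rho (g * h)%g v = rho g (rho h v).
Hypothesis rho_gen : forall s v,
  rho (cox_gen m s) v = v - form (alpha s) v *: alpha s.

(** Stated for words, since it serves to prove that the unfolding is well defined on
    [coxeter_group m]. *)
Lemma uact_eval_word u v :
  uact (eval_word (unfolded_gens L) u) (unfold_coord v) =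
  unfold_coord (rho (pres_class _ u) v).
Proof.
elim: u v => [|[s c] u IH] v; first by rewrite /eval_word big_nil uact1 rho1.
rewrite cox_class_cons rhoM /eval_word big_cons uactM -/(eval_word _ u) IH /=.
set w := rho _ v; have gens w' :
    uact (unfolded_gens L s) (unfold_coord w') =
    unfold_coord (rho (cox_gen m s) w').
  by rewrite rho_gen uact_unfolded_gens.
(* For an inverse letter, write w = s (s w) and cancel the outer [s]. *)
case: c => //; rewrite -[w in LHS]rho1 -(cox_gen2 m s) rhoM -gens -uactM mulVg.
exact: uact1.
Qed.

(** Applying [FPdim] to the coordinates of g alpha_x gives real matrix coefficients; left
    R-linearity of [rho] and multiplicativity of [FPdim] give their recursion. *)
Lemma rho_faithful g : (forall v, rho g v = v) -> g = 1%g.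
Proof.
move=> gid; pose B s t := FPdim K (form (alpha s) (alpha t)).
apply: (@geometric_faithful S (coxeter_group m) (cox_gen m) (@cox_gen2 S m)
  (@cox_gen_word S m) K m B (@cox_gen_rel S m) _ _ _ _
  (fun g x u => FPdim K (rho g (alpha x) u : R)))
  => [s|s t|s t k i st mst ik|s t st mst|x u|h p x u|x u].
- by rewrite /B gr_diag rmorph_nat.
- rewrite /B; have [->//|st] := eqVneq s t.
  by rewrite (gr_star L st) FPdim_star.
- rewrite /B (gr_FPdim_fin L st mst) mulNr opprK.
  exact: cheb_cos_ge0 (cox_offdiag st mst) ik.
- exact: gr_FPdim_inf.
- by rewrite rho1 ffunE rmorph_nat.
- rewrite rhoM rho_gen linearB linearZ /= -rmorphM -rmorphB /=.
  by congr (FPdim K _); rewrite !ffunE; congr (_ - _ * _).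
- by rewrite gid ffunE rmorph_nat.
Qed.

End Representation.

(** The image of a relator acts as the relator does through [rho], that is trivially, and the
    unfolded action is faithful. *)
Lemma unfolded_gens_relator u :
  coxeter_relator m u -> eval_word (unfolded_gens L) u = 1%g.
Proof.
have [rho [rho1 rhoM rho_gen]] := gr_action L.
move=> ru; apply: (cox_act_faithful unfolded_r_diag (unfolded_r_sym L)
  unfolded_r_fin unfolded_r_inf) => x.
rewrite -unfold_coord_basis (uact_eval_word rho1 rhoM rho_gen).
congr unfold_coord.
have -> : pres_class (coxeter_relator m) u = 1%g by apply/pres_classP/pres_rel.
exact: rho1.
Qed.

Definition unfolding : coxeter_group m -> coxeter_group (unfolded L) :=
  pres_lift (unfolded_gens L).

HB.instance Definition _ := isMultiplicative.Build (coxeter_group m)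
  (coxeter_group (unfolded L)) unfolding (pres_liftM unfolded_gens_relator).

(** Since [unfold_coord] is injective, [unfolding g] determines [rho g], and [rho] is faithful. *)
Lemma unfolding_inj : injective unfolding.
Proof.
have [rho [rho1 rhoM rho_gen]] := gr_action L.
have unfold_coord_inj : injective unfold_coord.
  move=> v w vw; apply/ffunP => s; apply: fr_coord_inj => i.
  exact: (congr1 (fun f => f (i, s)) vw).
have actE g v : uact (unfolding g) (unfold_coord v) = unfold_coord (rho g v).
  have [u ->] := pres_classK g.
  rewrite /unfolding (pres_lift_class unfolded_gens_relator).
  exact: (uact_eval_word rho1 rhoM rho_gen).
move=> g h gh; suff : (h^-1 * g)%g = 1%g.
  by move/(congr1 (fun x => h * x)%g); rewrite mulVKg mulg1.
apply: (rho_faithful rho1 rhoM rho_gen) => v; rewrite rhoM.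
have -> : rho g v = rho h v by apply: unfold_coord_inj; rewrite -!actE gh.
by rewrite -rhoM mulVg rho1.
Qed.

End Unfolding.

Theorem corollary4p5 (K : realType) (S : finType) (m : coxeterMatrix S)
    (R : fusionRing) (L : geomRealisation K m R) :
  exists phi : {multiplicative coxeter_group m -> coxeter_group (unfolded L)},
    (forall s : S, phi (cox_gen m s) = unfolded_gens L s) /\ injective phi.
Proof.
exists (unfolding L); split; last exact: unfolding_inj.
by move=> s; exact: pres_lift_gen (@unfolded_gens_relator K S m R L) s.
Qed.
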